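(* Fix positive integers $k$, $n$, $r$ with $k\le n$. There is a constant $C$ (depending only on $k,n,r$) such that for every prime power $q$, the number of $(k,r)$-evasive subsets of $\mathbb{F}_q^n$ is at most $2^{C q^{n-k}}$.
   Context: $\mathbb{F}_q$ is the finite field of order $q$. A set $S\subset\mathbb{F}_q^n$ is $(k,r)$-evasive if every variety in $\mathbb{F}_q^n$ of dimension $k$ and degree at most $1$ meets $S$ in fewer than $r$ points; equivalently, every $k$-dimensional affine subspace ($k$-flat) of $\mathbb{F}_q^n$ contains fewer than $r$ points of $S$.
   Formalization: The case k = n with r ≥ 2 is excluded: there the only n-flat is the whole space, so all q^n singletons are (n,r)-evasive while the bound 2^C does not grow with q, and the claim is false; all k < n, and k = n with r = 1, are covered. *)

(* Defs.v *)
From mathcomp Require Import all_boot all_order all_algebra.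

Set Implicit Arguments.
Unset Strict Implicit.
Unset Printing Implicit Defensive.

Local Open Scope ring_scope.

(* A translate of a k-dimensional linear subspace; every such subspace of F^n
   is the row space of some n x n matrix of rank k. *)
Definition is_flat (F : finFieldType) (n k : nat) (A : {set 'rV[F]_n}) : bool :=
  [exists p : 'rV[F]_n, exists V : 'M[F]_n,
    (\rank V == k) && (A == [set x | (x - p <= V)%MS])].

Definition evasive (F : finFieldType) (n k r : nat) (S : {set 'rV[F]_n}) : bool :=
  [forall A : {set 'rV[F]_n}, is_flat k A ==> (#|A :&: S| < r)%N].

(* Main.v *)
Require Import Defs.
From mathcomp Require Import all_boot all_order all_algebra.
From mathcomp Require Import zify.
Set Implicit Arguments.
Unset Strict Implicit.
Unset Printing Implicit Defensive.

(**
A container argument that uses only second moments. Put [d = n - k] and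
[Q = q ^ d]. The [k]-flats [u + v N = c], for [N] a [k x d] matrix and [c] a
vector, contain each point with frequency exactly [1/Q] and each pair of
points with frequency at most [1/Q^2]. Hence if [L] is a set of such flats of
density [a], at most [4 Q / a] points have less than half of the expected
degree [|L| / Q] in [L].

Fix [t <= Q] and an evasive [S], and start from [L] = all these flats. Either
all but [t] points of [S] lie in the small set of points of low degree in [L],
or [t] points of [S] of high degree meet a fraction of at least [t / (2 r Q)]
of [L], each flat containing fewer than [r] points of [S]; then pass to the
flats of [L] that they meet. As every pass puts a further point of [S] on all
flats of [L], there are fewer than [r] passes. So [S] is, up to at most [r]
sets of [t] points, inside a set of size [O(Q (Q / t) ^ r)] determined by these
points. Iterating with [t = Q / 2 ^ i] for decreasing [i], each time choosing
the [t] points inside the previous container, costs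
[sum_i O(i Q / 2 ^ i) = O(Q)] bits and ends in a container of size [O(Q)].
*)

(** * Binomial sums and geometric series *)

Lemma expSn_le_double (m h : nat) : h.*2 <= m.+1 -> m.+1 ^ h <= 2 * m ^ h.
Proof.
move=> hm.
(* Bernoulli's inequality [(1 - 1/(m+1))^i >= 1 - i/(m+1)] without denominators; at [i = h] its
   right side is at least 1/2. *)
have bern i : i <= m.+1 -> m.+1 ^ i * (m.+1 - i) <= m ^ i * m.+1.
  elim: i => [|i IH] hi; first by rewrite !expn0 !mul1n subn0.
  have {}IH := IH (ltnW hi).
  rewrite !expnS subSS.
  have hle : m.+1 * (m - i) <= m * (m.+1 - i) by nia.
  rewrite mulnAC; apply: (leq_trans (leq_mul hle (leqnn _))).
  by rewrite -!mulnA leq_mul2l [_ * m.+1 ^ i]mulnC IH orbT.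
have hb := bern h ltac:(lia).
rewrite -(leq_pmul2r (ltn0Sn m)) -mulnA (leq_trans _ (leq_mul (leqnn 2) hb)) //.
by rewrite mulnCA leq_mul2l; apply/orP; right; lia.
Qed.

Lemma expSn_le_4 (m : nat) : m.+1 ^ m <= 4 * m ^ m.
Proof.
have h1 := @expSn_le_double m (uphalf m) ltac:(lia).
have h2 := @expSn_le_double m m./2 ltac:(lia).
have e : m = uphalf m + m./2 by lia.
rewrite [X in _ ^ X]e [X in 4 * _ ^ X]e !expnD.
by apply: leq_trans (leq_mul h1 h2) _; rewrite mulnACA.
Qed.

(** In the expansion of [(m + 1) ^ (m * t)] the terms with [i <= t] are at least
    ['C(n, i) * m ^ (m * t - t)], and the whole power is at most [(4 * m ^ m) ^ t]. *)
Lemma sum_bin_le (n m t : nat) : 0 < m -> n <= m * t ->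
  \sum_(i < t.+1) 'C(n, i) <= (4 * m) ^ t.
Proof.
move=> m0 hn.
rewrite -(@leq_pmul2r (m ^ (m * t))) ?expn_gt0 ?m0 //.
have tN : t <= m * t by rewrite leq_pmull.
have -> : (4 * m) ^ t * m ^ (m * t) = m ^ t * (4 * m ^ m) ^ t.
  by rewrite !expnMn -expnM mulnCA mulnA.
apply: (@leq_trans (m ^ t * m.+1 ^ (m * t))); last first.
  rewrite leq_mul2l expnM; case: (posnP t) => [->|t0]; first by rewrite orbT.
  by rewrite leq_exp2r // expSn_le_4 orbT.
rewrite -[m.+1]addn1 expnDn big_distrr big_distrl /=.
rewrite (big_ord_widen_cond (m * t).+1 xpredT
          (fun i => 'C(n, i) * m ^ (m * t))) //.
rewrite big_mkcond leq_sum //= => i _.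
case: ifP => // hi; rewrite exp1n muln1 mulnCA.
rewrite leq_mul ?leq_bin2l // -expnD leq_pexp2l //; lia.
Qed.

Lemma card_small_subsets (T : finType) (A : {set T}) (t : nat) :
  #|[set B : {set T} | B \subset A & #|B| <= t]| = \sum_(i < t.+1) 'C(#|A|, i).
Proof.
rewrite -sum1_card.
rewrite (partition_big (fun B : {set T} => inord #|B| : 'I_t.+1) xpredT) //=.
apply: eq_bigr => i _; rewrite -cards_draws -sum1_card; apply: eq_bigl => B.
rewrite !inE -andbA; congr (_ && _).
apply/andP/eqP => [[hB /eqP <-]|hB]; first by rewrite inordK.
by rewrite hB -ltnS; split; [exact: ltn_ord | rewrite inord_val].
Qed.

Lemma sum_half_powers_le (Q a : nat) : \sum_(i < a) Q %/ 2 ^ i <= 2 * Q.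
Proof.
elim: a Q => [|a IH] Q; first by rewrite big_ord0.
rewrite big_ord_recl expn0 divn1.
under eq_bigr => i _ do rewrite lift0 expnS divnMA.
apply: leq_trans (leq_add (leqnn Q) (IH (Q %/ 2))) _; lia.
Qed.

Lemma sum_weighted_half_powers_le (Q a : nat) :
  \sum_(i < a) i.+1 * (Q %/ 2 ^ i) <= 4 * Q.
Proof.
elim: a Q => [|a IH] Q; first by rewrite big_ord0.
rewrite big_ord_recl expn0 divn1 mul1n.
under eq_bigr => i _ do rewrite lift0 expnS divnMA mulSn.
rewrite big_split /=.
apply: leq_trans (leq_add (leqnn Q)
  (leq_add (sum_half_powers_le _ _) (IH (Q %/ 2)))) _; lia.
Qed.

Lemma card_bigcup_leq_sum (I T : finType) (P : pred I) (F : I -> {set T}) :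
  #|\bigcup_(i | P i) F i| <= \sum_(i | P i) #|F i|.
Proof.
elim/big_ind2: _ => [|A m B n hA hB|//]; first by rewrite cards0.
by apply: leq_trans (leq_card_setU _ _).1 (leq_add hA hB).
Qed.

(** * Second moments and containers for sparse sets *)

Section SparseSets.

Variables (V W : finType) (blk : W -> {set V}) (r : nat).

Definition sparse (S : {set V}) := [forall w, #|S :&: blk w| < r].

Lemma sparseS (S T : {set V}) : T \subset S -> sparse S -> sparse T.
Proof.
move=> sTS /forallP hS; apply/forallP => w.
by apply: leq_ltn_trans (hS w); rewrite subset_leq_card ?setSI.
Qed.

Lemma sum_block_card (L : {set W}) (A : {set V}) :
  \sum_(w in L) #|A :&: blk w| = \sum_(x in A) #|[set w in L | x \in blk w]|.
Proof.
transitivity (\sum_(w in L) \sum_(x in A) (x \in blk w)).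
  by apply: eq_bigr => w _; rewrite -sum1dep_card big_mkcondr.
by rewrite exchange_big; apply: eq_bigr => x _; rewrite -sum1dep_card big_mkcondr.
Qed.

Lemma sum_block_card_sqr (A : {set V}) :
  \sum_w #|A :&: blk w| ^ 2 =
  \sum_(x in A) \sum_(y in A) #|[set w | (x \in blk w) && (y \in blk w)]|.
Proof.
transitivity (\sum_w \sum_(x in A) \sum_(y in A) ((x \in blk w) && (y \in blk w))).
  apply: eq_bigr => w _.
  rewrite (_ : #|_| = \sum_(x in A) (x \in blk w)); last first.
    by rewrite -sum1dep_card big_mkcondr.
  rewrite -mulnn big_distrlr; apply: eq_bigr => x _; apply: eq_bigr => y _.
  by rewrite /= mulnb.
rewrite exchange_big; apply: eq_bigr => x _; rewrite exchange_big.
by apply: eq_bigr => y _; rewrite -sum1dep_card [RHS]big_mkcond.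
Qed.

Variable Q : nat.
Hypotheses (Q_gt0 : 0 < Q) (W_gt0 : 0 < #|W|)
  (deg : forall x, #|[set w | x \in blk w]| * Q = #|W|)
  (codeg : forall x y, x != y ->
     #|[set w | (x \in blk w) && (y \in blk w)]| * Q ^ 2 <= #|W|).

(* Pairwise negative correlation bounds the variance of [#|A :&: blk w|] over
   [w]; this is the resulting second-moment estimate. *)
Lemma card_low_degree (L : {set W}) (A : {set V}) :
  (forall x, x \in A -> #|[set w in L | x \in blk w]| * (2 * Q) <= #|L|) ->
  #|A| * #|L| <= 4 * Q * #|W|.
Proof.
move=> lowA.
pose y w := #|A :&: blk w|.
have sumL : (\sum_(w in L) y w) * (2 * Q) <= #|A| * #|L|.
  rewrite sum_block_card big_distrl -sum_nat_const /=.
  exact: leq_sum lowA.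
have sumW : (\sum_w y w) * Q = #|A| * #|W|.
  have -> : \sum_w y w = \sum_(w in [set: W]) y w.
    by apply: eq_bigl => w; rewrite inE.
  rewrite sum_block_card big_distrl -sum_nat_const /=.
  apply: eq_bigr => x _; rewrite -(deg x).
  by congr (#|pred_of_set _| * _); apply/setP => w; rewrite !inE.
have sumW2 : (\sum_w y w ^ 2) * Q ^ 2 <= #|A| * (Q * #|W|) + #|A| ^ 2 * #|W|.
  rewrite sum_block_card_sqr big_distrl -mulnn -mulnA -mulnDr -sum_nat_const /=.
  apply: leq_sum => x xA; rewrite (bigD1 x) //= mulnDl leq_add //.
    rewrite -(deg x) [X in _ <= X]mulnC -mulnA mulnn leq_mul2r.
    by rewrite subset_leq_card ?orbT //; apply/subsetP => w; rewrite !inE andbb.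
  rewrite big_distrl -sum_nat_const /= [X in _ <= X](bigD1 x) //=.
  rewrite (leq_trans _ (leq_addl _ _)) //.
  by apply: leq_sum => z /andP[_ zx]; rewrite codeg // eq_sym.
set al := #|A| in sumL sumW sumW2 *; set M := #|W| in sumW sumW2 *.
(* With [u = y w * Q], this sums [4 (u - al)^2 >= 0] over [w] outside [L] and [(2u - al)^2 >= 0]
   over [w] in [L]. *)
have key : 4 * ((\sum_w y w ^ 2) * Q ^ 2) + 4 * al ^ 2 * M
     + 2 * al * ((\sum_(w in L) y w) * (2 * Q)) >=
     3 * al ^ 2 * #|L| + 8 * al * ((\sum_w y w) * Q).
  have -> : 4 * ((\sum_w y w ^ 2) * Q ^ 2) + 4 * al ^ 2 * M
     + 2 * al * ((\sum_(w in L) y w) * (2 * Q)) =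
     \sum_w (4 * (y w ^ 2 * Q ^ 2) + 4 * al ^ 2
             + (w \in L) * (2 * al * (y w * (2 * Q)))).
    rewrite 2!big_split /=; congr (_ + _ + _).
    - by rewrite big_distrl big_distrr /=.
    - by rewrite sum_nat_const mulnC.
    rewrite big_distrl big_distrr /= [LHS]big_mkcond; apply: eq_bigr => w _.
    by case: (w \in L); rewrite ?mul1n ?mul0n.
  have -> : 3 * al ^ 2 * #|L| + 8 * al * ((\sum_w y w) * Q) =
     \sum_w ((w \in L) * (3 * al ^ 2) + 8 * al * (y w * Q)).
    rewrite big_split /=; congr (_ + _).
      by rewrite mulnC -sum1_card big_mkcond big_distrl.
    by rewrite big_distrl big_distrr /=.
  apply: leq_sum => w _; move: (y w) => z.
  have [c1 _] := nat_Cauchy (2 * (z * Q)) al; have [c2 _] := nat_Cauchy (z * Q) al.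
  rewrite [z * (2 * Q)]mulnCA -expnMn; move: (z * Q) c1 c2 => u; rewrite -!mulnn.
  by case: (w \in L); nia.
have [->//|al0] := posnP al.
rewrite -(leq_pmul2l al0).
rewrite sumW -!mulnn in key; rewrite -!mulnn in sumW2.
have sumL' := leq_mul (leqnn (2 * al)) sumL.
by move: #|L| (\sum_(w in L) y w) (\sum_w y w * y w) sumW2 sumL' key => l s2 s3; nia.
Qed.

(** Double counting of the incidences between [T] and [L]: each block contains fewer than [r] points
    of [T]. *)
Lemma card_sparse_through (L : {set W}) (T : {set V}) (t : nat) : sparse T ->
  #|T| = t ->
  (forall x, x \in T -> #|L| <= #|[set w in L | x \in blk w]| * (2 * Q)) ->
  t * #|L| <= 2 * r * Q * #|[set w in L | T :&: blk w != set0]|.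
Proof.
move=> /forallP spT cT hT.
have hs : t * #|L| <= (\sum_(w in L) #|T :&: blk w|) * (2 * Q).
  rewrite sum_block_card -cT -sum_nat_const big_distrl /=; exact: leq_sum hT.
apply: (leq_trans hs); rewrite mulnC -!mulnA leq_mul2l /=.
rewrite mulnCA leq_mul2l -sum1dep_card big_distrr big_mkcondr /=.
apply/orP; right; apply: leq_sum => w wL.
by rewrite muln1; case: eqP => [->|_]; rewrite ?cards0 // ltnW.
Qed.

Section Level.

(** One round with fixed [t]: [B] bounds [Q / t], and [X] is the count already known inside the
    containers that the round produces. *)
Variables (t X B : nat) (A : {set V}).
Hypotheses (t_gt0 : 0 < t) (Q_le : Q <= B * t)
  (containers : forall A' : {set V}, #|A'| <= 4 * (2 * r * B) ^ r * Q ->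
     #|[set S : {set V} | sparse S & S \subset A']| <= X).

Let Z := #|[set T : {set V} | T \subset A & #|T| <= t]|.

(** A pass lowers [i] by one and the density of [L] by a factor of at most [2 * r * B]. Choosing [T]
    costs a factor [Z]; the 2 pays for the choice between stopping ([E1]) and continuing ([E2]). *)
Lemma card_sparse_level (i : nat) (L : {set W}) : i <= r ->
  #|W| <= #|L| * (2 * r * B) ^ (r - i) ->
  #|[set S : {set V} | [&& sparse S, S \subset A &
       [forall w in L, #|S :&: blk w| < i]]]| <= (2 * Z) ^ i * X.
Proof.
have Z_gt0 : 0 < Z by apply/card_gt0P; exists set0; rewrite inE sub0set cards0.
elim: i L => [|i IH] L hi hL.
  have [L0|[w wL]] := set_0Vmem L.
    by move: hL; rewrite L0 cards0 mul0n leqNgt W_gt0.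
  rewrite (_ : [set _ | _] = set0) ?cards0 //; apply/setP => S; rewrite !inE.
  by apply/negP => /and3P[_ _ /forall_inP/(_ w wL)].
pose A' := [set x in A | #|[set w in L | x \in blk w]| * (2 * Q) <= #|L|].
have cA' : #|A'| <= 4 * (2 * r * B) ^ r * Q.
  have lowA' : #|A'| * #|L| <= 4 * Q * #|W|.
    by apply: card_low_degree => x; rewrite inE => /andP[].
  have L0 : 0 < #|L|.
    by case: (posnP #|L|) hL => // ->; rewrite mul0n leqNgt W_gt0.
  rewrite -(leq_pmul2r L0); apply: (leq_trans lowA').
  have r0 : 0 < r by apply: leq_ltn_trans hi.
  have B0 : 0 < B by case: (posnP B) Q_le => // ->; rewrite mul0n leqNgt Q_gt0.
  have hL' : #|W| <= #|L| * (2 * r * B) ^ r.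
    apply: (leq_trans hL); rewrite leq_mul2l leq_pexp2l ?orbT ?leq_subr //.
    by rewrite !muln_gt0 r0 B0.
  by apply: leq_trans (leq_mul (leqnn (4 * Q)) hL') _; apply: eq_leq; lia.
pose small := [set T : {set V} | T \subset A & #|T| <= t].
pose E1 := [set T :|: S |
  T in small, S in [set S : {set V} | sparse S & S \subset A']].
pose LT (T : {set V}) := [set w in L | T :&: blk w != set0].
pose F T := [set S : {set V} | [&& sparse S, S \subset A &
       [forall w in LT T, #|S :&: blk w| < i]]].
pose E2 := \bigcup_(T in small | #|W| <= #|LT T| * (2 * r * B) ^ (r - i)) [set T :|: S | S in F T].
apply: (@leq_trans #|E1 :|: E2|).
  apply: subset_leq_card; apply/subsetP => S; rewrite !inE.
  case/and3P=> spS SA /forall_inP SL.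
  have [le_t|gt_t] := leqP #|S :\: A'| t.
    apply/orP; left; apply/imset2P; exists (S :\: A') (S :&: A').
    - by rewrite inE le_t andbT (subset_trans (subsetDl _ _)).
    - by rewrite inE subsetIr (sparseS (subsetIl _ _) spS).
    - by rewrite setUC setID.
  apply/orP; right.
  have [T sT cT] : exists2 T : {set V}, T \subset S :\: A' & #|T| = t.
    have : 0 < #|[set T : {set V} | T \subset S :\: A' & #|T| == t]|.
      by rewrite cards_draws bin_gt0 ltnW.
    by case/card_gt0P => T; rewrite inE => /andP[? /eqP]; exists T.
  have sTS : T \subset S := subset_trans sT (subsetDl _ _).
  have Tsmall : T \in small by rewrite inE cT leqnn andbT (subset_trans sTS).
  apply/bigcupP; exists T.
    rewrite Tsmall /=.
    have hT := @card_sparse_through L T t (sparseS sTS spS) cT.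
    have {}hT : t * #|L| <= 2 * r * Q * #|LT T|.
      apply: hT => x /(subsetP sT); rewrite !inE => /andP[nA' xS].
      by move: nA'; rewrite (subsetP SA _ xS) /= -ltnNge => /ltnW.
    have {}hT : #|L| <= 2 * r * B * #|LT T|.
      rewrite -(leq_pmul2l t_gt0) (leq_trans hT) //.
      have := leq_mul (leqnn (2 * r * #|LT T|)) Q_le; lia.
    apply: (leq_trans hL); rewrite -(subnSK hi) expnS.
    by rewrite mulnA leq_mul2r (mulnC #|LT T|) hT orbT.
  apply/imsetP; exists (S :\: T); last by rewrite -{1}(setID S T) (setIidPr sTS).
  rewrite inE (sparseS (subsetDl _ _) spS) (subset_trans (subsetDl _ _) SA) /=.
  (* A block met by [T] loses a point when [T] is removed from [S], so its bound drops from [i.+1]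
     to [i]. *)
  apply/forall_inP => w; rewrite inE => /andP[wL /set0Pn[x]].
  rewrite inE => /andP[xT xw]; have := SL w wL; rewrite ltnS; apply: leq_trans.
  apply: proper_card; apply/properP; split; first by rewrite setSI ?subsetDl.
  by exists x; rewrite !inE ?xT ?xw ?(subsetP sTS).
apply: (leq_trans (leq_card_setU _ _).1).
have cE1 : #|E1| <= Z * X.
  rewrite /E1 curry_imset2X (leq_trans (leq_imset_card _ _)) // cardsX.
  by rewrite leq_mul ?containers.
have cE2 : #|E2| <= Z * ((2 * Z) ^ i * X).
  apply: (leq_trans (card_bigcup_leq_sum _ _)).
  rewrite -sum_nat_const big_mkcondr leq_sum //= => T _; case: ifP => // hT.
  by apply: leq_trans (leq_imset_card _ _) (IH _ (ltnW hi) hT).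
have p0 : 0 < (2 * Z) ^ i by rewrite expn_gt0 muln_gt0 Z_gt0.
rewrite expnS; nia.
Qed.

Lemma card_sparse_step (m : nat) : 0 < m -> #|A| <= m * t ->
  #|[set S : {set V} | sparse S & S \subset A]| <= (8 * m) ^ (t * r) * X.
Proof.
move=> m0 hA; have := @card_sparse_level r [set: W] (leqnn r).
rewrite subnn expn0 muln1 cardsT => /(_ (leqnn _)) h.
apply: (@leq_trans ((2 * Z) ^ r * X)).
  apply: leq_trans h; apply: subset_leq_card; apply/subsetP => S; rewrite !inE.
  by move=> /andP[spS ->]; rewrite spS; apply/forall_inP => w _; exact: (forallP spS).
rewrite leq_mul2r expnM; apply/orP; right.
have hZ : 2 * Z <= (8 * m) ^ t.
  rewrite (_ : 8 * m = 2 * (4 * m)); last by rewrite mulnA.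
  rewrite expnMn leq_mul //.
    exact: (@leq_pexp2l 2 1 t).
  by rewrite /Z card_small_subsets sum_bin_le.
by case: (posnP r) => [->//|r0]; rewrite leq_exp2r.
Qed.

End Level.

(* [lam i * Q] bounds the container left by the step with [t = Q %/ 2 ^ i]. *)
Let lam i := 4 * (2 * r * 2 ^ i.+1) ^ r.
(** Chosen so that [8 * (lam j * 2 ^ j) <= 2 ^ (beta * j)] for [j > 0]; the left side is the base in
    the cost of a round. *)
Let beta := r * r + 3 * r + 6.

(** The round with [t = Q %/ 2 ^ a] and [B = 2 ^ a.+1] leads from containers of size [lam a.+1 * Q]
    to size [lam a * Q]; in the last container all subsets are counted. *)
Lemma card_sparse_iter (a : nat) (A : {set V}) : 0 < r ->
  (forall i, i < a -> 2 ^ i <= Q) -> #|A| <= lam a * Q ->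
  #|[set S : {set V} | sparse S & S \subset A]| <=
    2 ^ (lam 0 * Q + beta * r * \sum_(i < a) i.+1 * (Q %/ 2 ^ i)).
Proof.
move=> r0; elim: a A => [|a IH] A hQ hA.
  rewrite big_ord0 muln0 addn0; apply: (@leq_trans (2 ^ #|A|)).
    rewrite -card_powerset; apply: subset_leq_card; apply/subsetP => S.
    by rewrite !inE => /andP[].
  by rewrite leq_exp2l.
have {}IH A' hA' := IH A' (fun i hi => hQ i (ltnW hi)) hA'.
have t0 : 0 < Q %/ 2 ^ a by rewrite divn_gt0 ?expn_gt0 // hQ.
(* The quotient is positive, so rounding it down loses at most a factor 2. *)
have Q_le : Q <= 2 ^ a.+1 * (Q %/ 2 ^ a).
  have p0 : 0 < 2 ^ a by rewrite expn_gt0.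
  have h1 := divn_eq Q (2 ^ a); have h2 := ltn_pmod Q p0.
  rewrite expnS; nia.
have lam0 : 0 < lam a.+1 * 2 ^ a.+1 by rewrite !(muln_gt0, expn_gt0) r0.
have cA : #|A| <= lam a.+1 * 2 ^ a.+1 * (Q %/ 2 ^ a).
  by apply: leq_trans hA _; rewrite -mulnA leq_mul2l Q_le orbT.
apply: leq_trans (card_sparse_step t0 Q_le IH lam0 cA) _.
rewrite big_ord_recr /= mulnDr addnA [X in _ <= X]expnD mulnC leq_mul2l.
apply/orP; right.
have hb : 8 * (lam a.+1 * 2 ^ a.+1) <= 2 ^ (beta * a.+1).
  have hr : 2 * r <= 2 ^ r.+1 by rewrite expnS leq_mul2l /= ltnW // ltn_expl.
  have hlam : lam a.+1 <= 2 ^ (2 + (r.+1 + a.+2) * r).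
    rewrite /lam expnD leq_mul2l /= [2 ^ (_ * r)]expnM leq_exp2r // expnD.
    by rewrite leq_mul2r hr orbT.
  apply: (@leq_trans (2 ^ (3 + (2 + (r.+1 + a.+2) * r + a.+1)))).
    by rewrite expnD leq_mul2l /= expnD leq_mul2r hlam orbT.
  by rewrite leq_exp2l // /beta; nia.
apply: (@leq_trans ((2 ^ (beta * a.+1)) ^ (Q %/ 2 ^ a * r))).
  by rewrite leq_exp2r // muln_gt0 t0.
by rewrite -expnM leq_exp2l //; apply: eq_leq; lia.
Qed.

Lemma card_sparse : 0 < r -> #|V| <= Q ^ r.+1 ->
  #|[set S : {set V} | sparse S]| <= 2 ^ ((lam 0 + 4 * beta * r) * Q).
Proof.
(* Here [2 ^ i <= Q] for all [i < a], but [Q < 2 ^ a]; so [lam a >= Q ^ r], and the whole space can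
   be the first container. *)
move=> r0 hV; pose a := (trunc_log 2 Q).+1.
have hQ i : i < a -> 2 ^ i <= Q.
  rewrite ltnS => hi; apply: (@leq_trans (2 ^ trunc_log 2 Q)).
    by rewrite leq_exp2l.
  exact: trunc_logP.
have hA : #|[set: V]| <= lam a * Q.
  rewrite cardsT (leq_trans hV) // expnSr leq_mul2r; apply/orP; right.
  apply: (@leq_trans ((2 ^ a) ^ r)).
    by rewrite leq_exp2r // ltnW // trunc_log_ltn.
  rewrite /lam (leq_trans _ (leq_pmull _ _)) // leq_exp2r // expnS.
  have := expn_gt0 2 a; nia.
have := card_sparse_iter r0 hQ hA.
rewrite (eq_finset (fun S => sparse S)); last by move=> S; rewrite subsetT andbT.
move/leq_trans; apply; rewrite leq_exp2l // mulnDl leq_add2l.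
apply: leq_trans (leq_mul (leqnn _) (sum_weighted_half_powers_le Q a)) _.
by rewrite mulnA (mulnC _ 4) mulnA.
Qed.

End SparseSets.

(** * Flats that are graphs, and their incidences *)

Section Flats.
Import GRing.Theory.
Local Open Scope ring_scope.
Variables (F : finFieldType) (d k : nat).

(** For [x = (u, v)] and [w = (N, c)], the graph of the affine map sending [v] to [c - v N]. The
    parameters [N] and [c] are free, so incidences are counted by solving linear equations in
    them. *)
Definition graph_flat (w : 'M[F]_(k, d) * 'rV[F]_d) : {set 'rV[F]_(d + k)} :=
  [set x | lsubmx x + rsubmx x *m w.1 == w.2].

Lemma is_flat_graph_flat w : is_flat k (graph_flat w).
Proof.
case: w => N c; apply/existsP; exists (row_mx c 0); apply/existsP.
(* The direction space is spanned by the rows of [(-N | 1)], padded with zero rows to a square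
   matrix. *)
exists (block_mx 0 0 (- N) 1%:M); apply/andP; split.
  rewrite /block_mx row_mx0 rank_col_0mx; apply/row_freeP.
  by exists (col_mx 0 1%:M); rewrite mul_row_col mulmx0 add0r mulmx1.
apply/eqP/setP => x; rewrite !inE /=.
have -> : x - row_mx c 0 = row_mx (lsubmx x - c) (rsubmx x).
  by rewrite -{1}[x]hsubmxK opp_row_mx add_row_mx oppr0 addr0.
apply/eqP/submxP => [<-|[D]].
  exists (row_mx 0 (rsubmx x)); rewrite mul_row_block !mul0mx !add0r.
  by rewrite mulmx1 mulmxN opprD addNKr.
rewrite -[D]hsubmxK mul_row_block !mulmx0 !add0r mulmx1 => /eq_row_mx[h ->].
by move: h; rewrite mulmxN => /eqP; rewrite subr_eq addrC => /eqP->; rewrite subrK.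
Qed.

Lemma card_graph_flat_through (x : 'rV[F]_(d + k)) :
  (#|[set w | x \in graph_flat w]| * #|F| ^ d)%N = #|{: 'M[F]_(k, d) * 'rV[F]_d}|.
Proof.
rewrite card_prod !card_mx mul1n; congr (_ * _)%N.
rewrite -card_mx -cardsT.
rewrite (_ : [set w | _] = (fun N : 'M[F]_(k, d) => (N, lsubmx x + rsubmx x *m N)) @: setT).
  by rewrite card_imset // => N1 N2 [].
apply/setP => -[N c]; rewrite !inE /=; apply/eqP/imsetP => [<-|[N' _ [-> ->]] //].
by exists N.
Qed.

(** If [w e = 1], adding [e z'] to [N] shifts [w N] by [z']; so the translates of the fiber by the
    [e z'] are disjoint. *)
Lemma card_mulmx_fiber (w : 'rV[F]_k) (z : 'rV[F]_d) : w != 0 ->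
  (#|[set N : 'M[F]_(k, d) | w *m N == z]| * #|F| ^ d <= #|F| ^ (k * d))%N.
Proof.
move=> w0.
have [e we] : exists e : 'cV[F]_k, w *m e = 1%:M.
  have /rV0Pn[i wi] := w0; exists ((w 0 i)^-1 *: delta_mx i 0).
  rewrite -scalemxAr -colE; apply/matrixP => a b.
  by rewrite !ord1 !mxE eqxx mulVf.
have -> : (#|F| ^ d = #|[set: 'rV[F]_d]|)%N by rewrite cardsT card_mx mul1n.
rewrite -cardsX -card_mx.
pose f (p : 'M[F]_(k, d) * 'rV[F]_d) := p.1 + e *m p.2.
rewrite -(@card_in_imset _ _ f); first exact: max_card.
move=> [N1 z1] [N2 z2]; rewrite !inE /= !andbT => /eqP h1 /eqP h2.
rewrite /f /= => e12.
have ez : z1 = z2.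
  have := congr1 (mulmx w) e12.
  by rewrite !mulmxDr h1 h2 !mulmxA we !mul1mx => /addrI.
by move: e12; rewrite ez => /addIr ->.
Qed.

(** Subtracting the two equations leaves a linear condition on [N], and [N] determines [c]. If the
    [v]-parts of [x] and [y] agree, their [u]-parts differ and no [N] works. *)
Lemma card_graph_flat_through2 (x y : 'rV[F]_(d + k)) : x != y ->
  (#|[set w | (x \in graph_flat w) && (y \in graph_flat w)]| * (#|F| ^ d) ^ 2
     <= #|{: 'M[F]_(k, d) * 'rV[F]_d}|)%N.
Proof.
move=> xy; rewrite card_prod !card_mx mul1n -mulnn mulnA leq_mul2r.
apply/orP; right.
pose G := [set N : 'M[F]_(k, d) | rsubmx (x - y) *m N == lsubmx (y - x)].
apply: (@leq_trans (#|G| * #|F| ^ d)%N).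
  rewrite leq_mul2r; apply/orP; right.
  apply: leq_trans (leq_imset_card (fun N => (N, lsubmx x + rsubmx x *m N)) G).
  apply: subset_leq_card; apply/subsetP => -[N c]; rewrite !inE /=.
  move=> /andP[/eqP hx /eqP hy]; apply/imsetP; exists N; last by rewrite hx.
  rewrite inE !linearB /= mulmxBl subr_eq addrAC eq_sym subr_eq.
  by rewrite hy -hx addrC.
have [r0|r0] := eqVneq (rsubmx (x - y)) 0; last exact: card_mulmx_fiber.
rewrite (_ : G = set0) ?cards0 ?mul0n //; apply/setP => N; rewrite !inE r0 mul0mx.
apply: contraNF xy => /eqP l0; rewrite -subr_eq0 -[x - y]hsubmxK r0.
by rewrite -opprB linearN /= -l0 oppr0 row_mx0.
Qed.

End Flats.

(** * Counting evasive sets *)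

Lemma evasive_leq (F : finFieldType) (n k r s : nat) (S : {set 'rV[F]_n}) :
  r <= s -> evasive k r S -> evasive k s S.
Proof.
move=> rs /forall_inP h; apply/forall_inP => A fA.
exact: leq_trans (h A fA) rs.
Qed.

(** If [k = n], the evasive sets are those with fewer than [r] points. For [r >= 2] these include
    all singletons, too many for a bound independent of the field; hence [hdeg]. *)
Theorem theorem3 (k n r : nat) (hk : 0 < k) (hn : 0 < n) (hr : 0 < r)
    (hkn : k <= n) (hdeg : k = n -> r = 1) :
  exists C : nat, forall F : finFieldType,
    #|[set S : {set 'rV[F]_n} | evasive k r S]| <= 2 ^ (C * #|F| ^ (n - k)).
Proof.
have [ekn|nkn] := eqVneq k n.
  exists 0 => F; rewrite mul0n expn0.
  apply: (@leq_trans #|[set set0 : {set 'rV[F]_n}]|); last by rewrite cards1.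
  apply: subset_leq_card; apply/subsetP => S; rewrite !inE hdeg // ekn.
  move=> /forall_inP/(_ setT); rewrite ltnS leqn0 setTI cards_eq0; apply.
  apply/existsP; exists 0%R; apply/existsP; exists 1%:M%R.
  by rewrite mxrank1 eqxx; apply/eqP/setP => x; rewrite !inE submx1.
have [d en] : {d | n = d.+1 + k} by exists (n - k).-1; lia.
rewrite {}en addnK {hkn hdeg hn nkn}.
(* Raising [r] to [s] keeps evasive sets evasive and gives [q ^ (d.+1 + k) <= Q ^ s.+1], the size
   condition of [card_sparse]. *)
pose s := r + d.+1 + k.
eexists => F; pose Q := #|F| ^ d.+1.
have F1 : 1 < #|F| by exact: card_finNzRing_gt1.
have := @card_sparse _ _ (@graph_flat F d.+1 k) s Q.
rewrite /Q expn_gt0 (ltnW F1) => /(_ isT).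
have W0 : 0 < #|{: 'M[F]_(k, d.+1) * 'rV[F]_d.+1}|.
  by apply/card_gt0P; exists (0, 0)%R.
move=> /(_ W0 (@card_graph_flat_through F _ _) (@card_graph_flat_through2 F _ _)).
have s0 : 0 < s by rewrite /s; lia.
move=> /(_ s0) h; apply: leq_trans (h _).
  apply: subset_leq_card; apply/subsetP => S; rewrite !inE => evS.
  apply/forallP => w; rewrite setIC.
  have rs : r <= s by rewrite /s; lia.
  exact: forall_inP (evasive_leq rs evS) _ (is_flat_graph_flat w).
rewrite card_mx mul1n -expnM leq_exp2l // /s; nia.
Qed.
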